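(* Let $F_n$ be the free group on $n \geq 2$ generators. Let $\{H_i\alpha_i\}_{i=1}^{s}$ be a coset partition of $F_n$ with $H_i<F_n$ of index $d_i>1$, $\alpha_i \in F_n$, $1 \leq i \leq s$. Suppose that $1\le j,k\le s$ are such that one of the following conditions holds: (i) $\bigcap_{i=1}^{s}\alpha_i^{-1}H_i\alpha_i \subsetneqq \bigcap_{i\neq j,k}\alpha_i^{-1}H_i\alpha_i$; (ii) $\operatorname{lcm}(d_j,d_k)$ does not divide the index $[F_n: \bigcap_{i\neq j,k}\alpha_i^{-1}H_i\alpha_i]$. Then $\{H_i\alpha_i\}_{i=1}^{s}$ has multiplicity. Furthermore, $H_j=H_k$.
   Context: A coset partition of a group $G$ is a finite family $\{H_i\alpha_i\}_{i=1}^{s}$ of right cosets of subgroups $H_i\le G$ ($\alpha_i\in G$) that are pairwise disjoint and whose union is $G$; here all $H_i$ have finite index $d_i$. It has multiplicity if $d_i=d_{i'}$ for some $i\ne i'$. Intersections $\bigcap_{i\ne j,k}$ are over all $1\le i\le s$ with $i\ne j$ and $i\neq k$ (an empty intersection being $F_n$). *)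

(* Defs.v *)
From HB Require Import structures.
From mathcomp Require Import all_boot.
From mathcomp Require Import boolp classical_sets functions cardinality.
From mathcomp Require Import finmap.

Set Implicit Arguments.
Unset Strict Implicit.
Unset Printing Implicit Defensive.

Local Open Scope classical_set_scope.
Local Open Scope group_scope.

Section FreeGroup.

Variable n : nat.

(* (i, false) stands for the generator x_i and (i, true) for its inverse. *)
Definition letter : Type := ('I_n * bool)%type.

Definition letter_inv (x : letter) : letter := (x.1, ~~ x.2).

Definition reduced (w : seq letter) : bool :=
  sorted (fun x y => y != letter_inv x) w.

Record free_group : Type := FreeGroup {
  word :> seq letter;
  word_reduced : reduced word }.

HB.instance Definition _ := [isSub for word].
HB.instance Definition _ := [Choice of free_group by <:].

(* The reduced form of x :: w, when w is reduced. *)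
Definition cons_red (x : letter) (w : seq letter) : seq letter :=
  if w is y :: w' then if y == letter_inv x then w' else x :: w else [:: x].

Definition mul_word (u v : seq letter) : seq letter := foldr cons_red v u.

Definition inv_word (u : seq letter) : seq letter := rev (map letter_inv u).

Lemma letter_invK : involutive letter_inv.
Proof. by case=> i b; rewrite /letter_inv /= negbK. Qed.

Lemma cons_red_reduced x w : reduced w -> reduced (cons_red x w).
Proof.
case: w => [|y w] //=; case: ifP => [_|/negbT ne].
  by rewrite /reduced; exact: path_sorted.
by rewrite /reduced /= ne.
Qed.

Lemma mul_word_reduced u v : reduced v -> reduced (mul_word u v).
Proof. by move=> rv; elim: u => //= x u; exact: cons_red_reduced. Qed.

Lemma cons_redK x w :
  reduced w -> cons_red x (cons_red (letter_inv x) w) = w.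
Proof.
case: w => [|y w] /=; first by rewrite eqxx.
rewrite letter_invK; case: eqP => [->|_]; last by rewrite /= eqxx.
by case: w => [|z w] //= /andP[/negPf->].
Qed.

Lemma mul_cons_red x v w :
  reduced w -> mul_word (cons_red x v) w = cons_red x (mul_word v w).
Proof.
move=> rw; case: v => [|y v] //=; case: eqP => [->|_] //=.
by rewrite cons_redK // mul_word_reduced.
Qed.

Lemma mul_wordA u v w :
  reduced w -> mul_word u (mul_word v w) = mul_word (mul_word u v) w.
Proof. by move=> rw; elim: u => //= x u ->; rewrite mul_cons_red. Qed.

Lemma mul_word1 u : reduced u -> mul_word u [::] = u.
Proof.
elim: u => //= x u IH; rewrite /reduced /= => ru.
rewrite IH; last exact: path_sorted ru.
by case: u ru {IH} => //= y u /andP[/negPf->].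
Qed.

Lemma inv_word_reduced u : reduced u -> reduced (inv_word u).
Proof.
rewrite /reduced /inv_word rev_sorted sorted_map.
by apply: sub_sorted => x y /=; rewrite letter_invK eq_sym.
Qed.

Lemma inv_wordK u : inv_word (inv_word u) = u.
Proof.
by rewrite /inv_word map_rev revK; apply: mapK; exact: letter_invK.
Qed.

Lemma mulV_word u : mul_word (inv_word u) u = [::].
Proof.
rewrite /inv_word; elim: u => //= x u IH.
by rewrite rev_cons /mul_word foldr_rcons /= letter_invK eqxx.
Qed.

Definition free_group_one : free_group := @FreeGroup [::] isT.

Definition free_group_mul (u v : free_group) : free_group :=
  FreeGroup (mul_word_reduced u (word_reduced v)).

Definition free_group_inv (u : free_group) : free_group :=
  FreeGroup (inv_word_reduced (word_reduced u)).

Lemma free_group_mulA : associative free_group_mul.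
Proof.
by move=> u v w; apply: val_inj; apply: mul_wordA; exact: word_reduced.
Qed.

Lemma free_group_mul1 : left_id free_group_one free_group_mul.
Proof. by move=> u; apply: val_inj. Qed.

Lemma free_group_mulr1 : right_id free_group_one free_group_mul.
Proof. by move=> u; apply: val_inj; apply: mul_word1; exact: word_reduced. Qed.

Lemma free_group_mulV :
  left_inverse free_group_one free_group_inv free_group_mul.
Proof. by move=> u; apply: val_inj; exact: mulV_word. Qed.

Lemma free_group_mulrV :
  right_inverse free_group_one free_group_inv free_group_mul.
Proof.
by move=> u; apply: val_inj; rewrite /= -{1}[word u]inv_wordK mulV_word.
Qed.

HB.instance Definition _ := isGroup.Build free_group free_group_mulA
  free_group_mul1 free_group_mulr1 free_group_mulV free_group_mulrV.

End FreeGroup.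

Section CosetPartitions.

Variable G : groupType.

Definition subgroup (H : set G) : Prop := group_closed (mem H).

Definition rcoset (H : set G) (a : G) : set G := [set h * a | h in H].

Definition rcosets (H : set G) : set (set G) := [set rcoset H a | a in setT].

Definition finite_index (H : set G) : Prop := finite_set (rcosets H).

(* The index [G : H], meaningful when H has finite index: as fset_set sends an
   infinite set to fset0, a subgroup of infinite index gets the value 0. *)
Definition subgroup_index (H : set G) : nat := #|` fset_set (rcosets H)|%fset.

(* a^-1 H a, since h ^ a = a^-1 * (h * a). *)
Definition conj_subgroup (H : set G) (a : G) : set G := [set h ^ a | h in H].

Variable s : nat.

Definition coset_partition (H : 'I_s -> set G) (a : 'I_s -> G) : Prop :=
  [/\ forall i, subgroup (H i),
      forall i, finite_index (H i),
      trivIset setT (fun i => rcoset (H i) (a i)) &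
      \bigcup_i rcoset (H i) (a i) = setT].

Definition has_multiplicity (H : 'I_s -> set G) : Prop :=
  exists i i' : 'I_s, i <> i' /\ subgroup_index (H i) = subgroup_index (H i').

End CosetPartitions.

(* Main.v *)
Require Import Defs.
From mathcomp Require Import all_boot.
From mathcomp Require Import boolp classical_sets functions cardinality.
From mathcomp Require Import finmap.
Local Open Scope classical_set_scope.

(** Let [N] be the intersection of the [conj_subgroup (H i) (a i)] over [i]
    other than [j] and [k].  Every coset [H i * a i] with such an [i] is stable
    under right translation by [N], hence so is the complement
    [U = H j * a j \cup H k * a k] of their union.  If [g] in [N] does not fix
    [H j * a j], then [H j * a j * g] is a coset of [H j] contained in
    [H k * a k], so [H j] is a subgroup of [H k]; moreover [g] cannot fix
    [H k * a k] either, so the roles of [j] and [k] may be exchanged.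
    If every [g] in [N] fixes both cosets, then [N] is contained in both
    conjugates, which contradicts (i), and (ii) by multiplicativity of the
    index. *)

(** Sum over the image of [f]; this is the counting behind divisibility of indices. *)
Lemma card_fset_fibres (T U : choiceType) (f : T -> U) (A : {fset T}) m :
  (forall x, x \in A -> #|` [fset y in A | f y == f x]|%fset = m) ->
  #|` A|%fset = (#|` f @` A|%fset * m)%N.
Proof.
move=> fibre; rewrite !card_fset_sum1 (partition_big_imfset _ f) big_distrl /=.
apply: eq_big_seq => _ /imfsetP[x /= xA ->].
by rewrite mul1n -(fibre x xA) card_fset_sum1 big_fset_condE.
Qed.

Lemma image_set_inj (T U : Type) (f : T -> U) :
  injective f -> injective (fun A : set T => f @` A).
Proof.
move=> f_inj A B fAB; apply/funext => x.
by rewrite -(image_inj f_inj) fAB image_inj.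
Qed.

(** * Subgroups, right cosets and conjugates *)

Section Cosets.

Set Implicit Arguments.
Unset Strict Implicit.

Local Open Scope group_scope.

Variable G : groupType.
Implicit Types (H K : set G) (a x y : G).

Lemma subgroupP H :
  subgroup H <-> H 1 /\ (forall x y, H x -> H y -> H (x / y)).
Proof.
split=> [[H1 HB]|[H1 HB]].
  split=> [|x y /mem_set Hx /mem_set Hy]; first exact: (@set_mem _ H 1 H1).
  exact: (@set_mem _ H _ (HB x y Hx Hy)).
split=> [|x y Hx Hy]; first exact: (@mem_set _ H 1 H1).
exact: (@mem_set _ H _ (HB x y (@set_mem _ H x Hx) (@set_mem _ H y Hy))).
Qed.

Section Subgroup.

Variable H : set G.
Hypothesis sgH : subgroup H.

Lemma subgroup1 : H 1.
Proof. by case/subgroupP: sgH. Qed.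

Lemma subgroupV x : H x -> H x^-1.
Proof.
by case/subgroupP: sgH => H1 HB Hx; rewrite -(mul1g x^-1); exact: HB.
Qed.

Lemma subgroupM x y : H x -> H y -> H (x * y).
Proof.
case/subgroupP: sgH => _ HB Hx Hy.
by rewrite -(invgK y); apply: HB => //; exact: subgroupV.
Qed.

Lemma subgroupMl x y : H x -> H (x * y) <-> H y.
Proof.
move=> Hx; split=> [Hxy|]; last exact: subgroupM.
by rewrite -(mulKg x y); apply: subgroupM => //; exact: subgroupV.
Qed.

Lemma subgroupMr x y : H y -> H (x * y) <-> H x.
Proof.
move=> Hy; split=> [Hxy|Hx]; last exact: subgroupM.
by rewrite -(mulgK y x); apply: subgroupM => //; exact: subgroupV.
Qed.

End Subgroup.

Lemma mem_rcoset H a x : rcoset H a x <-> H (x * a^-1).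
Proof.
split=> [[h Hh <-]|Hx]; first by rewrite mulgK.
by exists (x * a^-1); rewrite ?mulgVK.
Qed.

Lemma mem_conj_subgroup H a x : conj_subgroup H a x <-> H (a * x * a^-1).
Proof.
split=> [[h Hh <-]|Hx]; first by rewrite /conjg !mulgA mulgV mul1g mulgK.
by exists (a * x * a^-1) => //; rewrite /conjg mulgVK mulKg.
Qed.

Lemma conj_subgroup_subgroup H a : subgroup H -> subgroup (conj_subgroup H a).
Proof.
move=> sgH; apply/subgroupP; split=> [|x y].
  by apply/mem_conj_subgroup; rewrite mulg1 mulgV; exact: subgroup1.
move=> /mem_conj_subgroup Hx /mem_conj_subgroup Hy; apply/mem_conj_subgroup.
have -> : a * (x / y) * a^-1 = a * x * a^-1 * (a * y * a^-1)^-1.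
  by rewrite !invgM invgK !mulgA mulgVK.
by apply: subgroupM => //; exact: subgroupV.
Qed.

Lemma bigcap_subgroup (I : Type) (P : set I) (F : I -> set G) :
  (forall i, subgroup (F i)) -> subgroup (\bigcap_(i in P) F i).
Proof.
move=> sgF; apply/subgroupP; split=> [i _|x y Fx Fy i Pi].
  exact: subgroup1.
by apply: subgroupM => //; [exact: Fx|apply: subgroupV => //; exact: Fy].
Qed.

(** The conjugate by [a] stabilises the coset of [a] under right translation, as [a * g * a^-1] lies
    in [H]. *)
Lemma rcoset_conj_subgroup H a x g : subgroup H -> conj_subgroup H a g ->
  rcoset H a (x * g) <-> rcoset H a x.
Proof.
move=> sgH /mem_conj_subgroup Hg; rewrite !mem_rcoset.
have -> : x * g * a^-1 = x * a^-1 * (a * g * a^-1) by rewrite !mulgA mulgVK.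
exact: subgroupMr.
Qed.

Lemma rcoset_translate H a g :
  [set x * g | x in rcoset H a] = rcoset H (a * g).
Proof.
rewrite /rcoset image_comp; congr image.
by apply/funext => x /=; rewrite mulgA.
Qed.

(** * Index: invariance under conjugation and divisibility *)

Lemma subgroup_index_infinite H : ~ finite_index H -> subgroup_index H = 0%N.
Proof.
rewrite /finite_index /subgroup_index /fset_set.
by case: pselect => // ? _; rewrite cardfs0.
Qed.

(** Left translation by [a^-1] is injective and carries the coset of [a * x] under [H] to that of
    [x] under the conjugate. *)
Lemma subgroup_index_conj H a :
  finite_index H -> subgroup_index (conj_subgroup H a) = subgroup_index H.
Proof.
move=> fH; rewrite /subgroup_index.
have -> : rcosets (conj_subgroup H a) =
    (fun C : set G => [set a^-1 * x | x in C]) @` rcosets H.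
  rewrite /rcosets image_comp; apply/seteqP; split=> _ [x _ <-].
    exists (a * x) => //=; rewrite /rcoset !image_comp; congr image.
    by apply/funext => h /=; rewrite /conjg !mulgA.
  exists (a^-1 * x) => //=; rewrite /rcoset !image_comp; congr image.
  by apply/funext => h /=; rewrite /conjg -!mulgA mulVKg.
rewrite fset_set_image // card_imfset //.
by apply: image_set_inj; exact: mulgI.
Qed.

(* Sorting the cosets of [H] by the coset of [K] containing them, the fibres
   are equinumerous because right translation permutes them transitively. *)
Lemma subgroup_index_dvd H K : subgroup H -> subgroup K -> H `<=` K ->
  (subgroup_index K %| subgroup_index H)%N.
Proof.
move=> sgH sgK HK.
(* An infinite index has the default value 0, which every number divides. *)
have [fH|/subgroup_index_infinite -> //] := pselect (finite_index H).
pose tr g (C : set G) := [set x * g | x in C].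
(* [f C] is the product set [K C]: it sends [H x] to [K x] without a choice of representative. *)
pose f C := \bigcup_(x in C) rcoset K x.
have tr_inj g : injective (tr g) by apply: image_set_inj => x y /mulIg.
have fE x : f (rcoset H x) = rcoset K x.
  apply/seteqP; split=> [z [y /mem_rcoset Hy /mem_rcoset Kz]|z Kz].
    apply/mem_rcoset; rewrite -(mulgVK y z) -mulgA.
    by apply: subgroupM => //; exact: HK.
  exists x => //; apply/mem_rcoset; rewrite mulgV; exact: subgroup1.
have rH x : rcoset H x \in fset_set (rcosets H).
  by rewrite in_fset_set //; apply: mem_set; exists x.
have rHP C : C \in fset_set (rcosets H) -> rcosets H C.
  by rewrite in_fset_set // => /set_mem.
have fibre_le x y :
    (#|` [fset C in fset_set (rcosets H) | f C == f (rcoset H x)]| <=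
     #|` [fset C in fset_set (rcosets H) | f C == f (rcoset H y)]|)%fset%N.
  rewrite !fE.
  set A := [fset C in _ | _ C == rcoset K x]%fset.
  (* Right translation by [x^-1 * y] takes [K x] to [K y], so it injects the fibre over [K x] into
     the fibre over [K y]. *)
  have <- : #|` (tr (x^-1 * y) @` A)|%fset = #|` A|%fset by exact: card_imfset.
  apply: fsubset_leq_card; apply/fsubsetP => _ /imfsetP[C /= + ->].
  rewrite in_fset inE => /andP[/rHP[z _ <-] /eqP] /=.
  rewrite fE => Kzx; rewrite in_fset inE /= /tr rcoset_translate [_ \in _]rH fE.
  by rewrite -rcoset_translate Kzx rcoset_translate mulVKg eqxx.
have -> : subgroup_index K = #|` f @` fset_set (rcosets H)|%fset.
  rewrite -fset_set_image // /rcosets image_comp /subgroup_index /rcosets.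
  by congr (#|` fset_set (image _ _)|%fset); apply/funext => x /=; rewrite fE.
rewrite /subgroup_index.
set m := #|` [fset C in fset_set (rcosets H) | f C == f (rcoset H 1)]|%fset.
rewrite [X in dvdn _ X](@card_fset_fibres _ _ f _ m) ?dvdn_mulr //.
move=> C /rHP[x _ <-].
by apply/eqP; rewrite eqn_leq !fibre_le.
Qed.

(** * Action of [N j k] on the cosets of the partition *)

Section Partition.

Variables (s : nat) (H : 'I_s -> set G) (a : 'I_s -> G).
Hypothesis cpH : coset_partition H a.

Let sgH i : subgroup (H i).
Proof. by case: cpH. Qed.

Let N j k :=
  \bigcap_(i in [set i | i <> j /\ i <> k]) conj_subgroup (H i) (a i).

Let rcoset_rep i : rcoset (H i) (a i) (a i).
Proof. by apply/mem_rcoset; rewrite mulgV; exact: subgroup1. Qed.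

Lemma coset_partition_uniq i i' x :
  rcoset (H i) (a i) x -> rcoset (H i') (a i') x -> i = i'.
Proof.
by case: cpH => _ _ tH _ Hx H'x; apply: tH => //; exists x.
Qed.

(** If [x * g] lay in a third coset, which [g] stabilises, so would [x], against disjointness. *)
Lemma translate_coset_pair j k g x : N j k g ->
  rcoset (H j) (a j) x \/ rcoset (H k) (a k) x ->
  rcoset (H j) (a j) (x * g) \/ rcoset (H k) (a k) (x * g).
Proof.
move=> Ng Ux; have [i _ ixg] : (\bigcup_i rcoset (H i) (a i)) (x * g).
  by case: cpH => _ _ _ ->.
have [<-|ij] := pselect (i = j); first by left.
have [<-|ik] := pselect (i = k); first by right.
move: ixg; rewrite rcoset_conj_subgroup; [|exact: sgH|exact: Ng].
by case: Ux => Ux /(coset_partition_uniq Ux) /esym.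
Qed.

(** Whether [h * a j * g] stays in the coset of [a j] depends only on [a j * g * (a j)^-1], not on
    [h]; so all points leave together. *)
Lemma moved_coset j k g : N j k g -> ~ conj_subgroup (H j) (a j) g ->
  forall h, H j h -> rcoset (H k) (a k) (h * a j * g).
Proof.
move=> Ng Hjg h Hh; have Hha : rcoset (H j) (a j) (h * a j).
  by apply/mem_rcoset; rewrite mulgK.
have [|//] := translate_coset_pair Ng (or_introl Hha).
move=> /mem_rcoset; rewrite -!mulgA subgroupMl // mulgA.
by move/mem_conj_subgroup.
Qed.

(** Both [a j * g] and [h * a j * g] lie in one right coset of [H k], so their quotient [h] is in
    [H k]. *)
Lemma moved_coset_sub j k g : N j k g -> ~ conj_subgroup (H j) (a j) g ->
  H j `<=` H k.
Proof.
move=> Ng Hjg h Hh; have Hk := moved_coset Ng Hjg.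
have /mem_rcoset := Hk _ Hh; rewrite -!mulgA subgroupMr //.
by have /mem_rcoset := Hk _ (subgroup1 (sgH j)); rewrite mul1g -!mulgA.
Qed.

Lemma N_subgroup j k : subgroup (N j k).
Proof. by apply: bigcap_subgroup => i; exact: conj_subgroup_subgroup. Qed.

Lemma moved_coset_eq j k g : N j k g -> ~ conj_subgroup (H j) (a j) g ->
  j <> k /\ H j = H k.
Proof.
move=> Ng Hjg; have jk : j <> k.
  move=> jk; subst k; apply/Hjg/mem_conj_subgroup/mem_rcoset.
  by rewrite -[a j * g]mul1g mulgA; apply: moved_coset => //; exact: subgroup1.
split=> //; apply/seteqP; split; first exact: moved_coset_sub Ng Hjg.
apply: (@moved_coset_sub _ _ g) => [i [ik ij]|Hkg]; first exact: Ng.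
(* Here [g] is assumed to stabilise the coset of [a k]. As [g^-1] also moves the coset of [a j], the
   point [a j * g^-1] lies in that of [a k]; applying [g] puts [a j] there too, so [j = k]. *)
apply: jk; apply: (@coset_partition_uniq _ _ (a j)) => //.
rewrite -(mulgVK g (a j)) rcoset_conj_subgroup //.
rewrite -[a j * g^-1]mul1g mulgA.
apply: moved_coset; last exact: subgroup1.
  exact: subgroupV (N_subgroup j k) _ Ng.
by move/(subgroupV (conj_subgroup_subgroup _ (sgH j))); rewrite invgK.
Qed.

End Partition.

End Cosets.

Theorem theorem3 (n s : nat) (H : 'I_s -> set (free_group n))
    (a : 'I_s -> free_group n) (j k : 'I_s) :
  (2 <= n)%N ->
  coset_partition H a ->
  (forall i : 'I_s, (1 < subgroup_index (H i))%N) ->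
  (\bigcap_(i in [set: 'I_s]) conj_subgroup (H i) (a i)
     `<` \bigcap_(i in [set i : 'I_s | i <> j /\ i <> k])
           conj_subgroup (H i) (a i)) \/
  ~ (lcmn (subgroup_index (H j)) (subgroup_index (H k))
       %| subgroup_index (\bigcap_(i in [set i : 'I_s | i <> j /\ i <> k])
                            conj_subgroup (H i) (a i)))%N ->
  has_multiplicity H /\ H j = H k.
Proof.
move=> _ cpH _ cond; have [sgH fiH _ _] := cpH.
set N := \bigcap_(i in [set i | i <> j /\ i <> k])
           conj_subgroup (H i) (a i) in cond.
suff [jk Hjk] : j <> k /\ H j = H k.
  by split=> //; exists j, k; rewrite Hjk.
have [Nj|/existsNP[g /not_implyP[Ng Hjg]]] :=
  pselect (N `<=` conj_subgroup (H j) (a j)); last exact: moved_coset_eq Ng Hjg.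
have [Nk|/existsNP[g /not_implyP[Ng Hkg]]] :=
  pselect (N `<=` conj_subgroup (H k) (a k)); last first.
  have [|kj ->] := moved_coset_eq (j := k) (k := j) cpH _ Hkg.
    by move=> i [ik ij]; exact: Ng.
  by split=> // /esym.
have sgN : subgroup N.
  by apply: bigcap_subgroup => i; exact: conj_subgroup_subgroup.
case: cond => [[_ []] g Ng i _|[]].
  have [->|ij] := pselect (i = j); first exact: Nj.
  have [->|ik] := pselect (i = k); first exact: Nk.
  exact: Ng.
(* Both indices are those of conjugates containing [N], hence divide the index of [N]. *)
rewrite dvdn_lcm -(subgroup_index_conj (a j) (fiH j)).
rewrite -(subgroup_index_conj (a k) (fiH k)).
by rewrite !subgroup_index_dvd //; exact: conj_subgroup_subgroup.
Qed.
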